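(* Let $\mathbf{S}$ be a real $n\times n$ normal matrix (for example, symmetric or orthogonal), with polar decomposition $\mathbf{S}=\mathbf{U}\mathbf{P}$ and eigendecompositions $\mathbf{U}=\mathbf{V}_1\mathbf{\Lambda}_1\mathbf{V}_1^H$ and $\mathbf{P}=\mathbf{V}_2\mathbf{\Lambda}_2\mathbf{V}_2^H$ as in the context. Then both $\mathbf{V}_1$ and $\mathbf{V}_2$ can be chosen to be equal. This implies that $p_{i,j}=\langle\mathbf{v}_{1,j},\mathbf{v}_{2,i}\rangle$ equals $1$ if $i=j$ and $0$ otherwise, and therefore, for every $\mathbf{f}\in\mathbb{R}^n$ and $1\le i,j\le n$, the Fourier transform satisfies $\mathcal{F}_{\mathbf{S}}(\mathbf{f})_{i,j}=\widehat{\mathbf{f}}_i$ if $i=j$, and $\mathcal{F}_{\mathbf{S}}(\mathbf{f})_{i,j}=0$ otherwise, where $\widehat{\mathbf{f}}_i=\langle\mathbf{v}_{2,i},\mathbf{f}\rangle$.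
   Context: A polar decomposition of a real $n\times n$ matrix $\mathbf{S}$ is $\mathbf{S}=\mathbf{U}\mathbf{P}$ with $\mathbf{U}$ orthogonal and $\mathbf{P}$ symmetric positive semi-definite. Both factors are normal, so they admit eigendecompositions $\mathbf{U}=\mathbf{V}_1\mathbf{\Lambda}_1\mathbf{V}_1^H$ and $\mathbf{P}=\mathbf{V}_2\mathbf{\Lambda}_2\mathbf{V}_2^H$ with $\mathbf{V}_1,\mathbf{V}_2$ unitary and $\mathbf{\Lambda}_1,\mathbf{\Lambda}_2$ diagonal. By convention, the eigenvalues in $\mathbf{\Lambda}_2$ are ordered increasingly by absolute value and those in $\mathbf{\Lambda}_1$ increasingly by complex phase. The columns of $\mathbf{V}_1$ and $\mathbf{V}_2$ are denoted $\mathbf{v}_{1,1},\dots,\mathbf{v}_{1,n}$ and $\mathbf{v}_{2,1},\dots,\mathbf{v}_{2,n}$, and $\langle \mathbf{u},\mathbf{w}\rangle=\mathbf{u}^H\mathbf{w}$. The Fourier transform associated with $\mathbf{S}$ is $\mathcal{F}_{\mathbf{S}}:\mathbb{R}^n\to\mathbb{C}^{n^2}$, $\mathcal{F}_{\mathbf{S}}(\mathbf{f})_{i,j}=\langle\mathbf{v}_{2,i},\mathbf{f}\rangle\langle\mathbf{v}_{1,j},\mathbf{v}_{2,i}\rangle$ for $1\le i,j\le n$.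
   Formalization: With both ordering conventions the claim fails (S = diag(2,-1)); so a common V1 = V2 is asserted once with the eigenvalues of P ordered by absolute value and once with those of U ordered by phase, not both at once; the formulas hold for every common choice. *)

(* Defs.v *)
From HB Require Import structures.
From mathcomp Require Import all_boot all_order all_algebra.
From mathcomp Require Import sesquilinear spectral.
From mathcomp Require Import complex.
From mathcomp Require Import reals trigo.

Set Implicit Arguments.
Unset Strict Implicit.
Unset Printing Implicit Defensive.

Import Order.TTheory GRing.Theory Num.Theory.
Local Open Scope ring_scope.
Local Open Scope sesquilinear_scope.

Notation toC := (real_complex _).

Section Definitions.
Variables (R : realType) (n : nat).
Local Notation C := R[i].

Definition real_normal (S : 'M[R]_n) : Prop := S *m S^T = S^T *m S.

Definition real_orthogonal (U : 'M[R]_n) : Prop := U *m U^T = 1%:M.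

Definition real_psd (P : 'M[R]_n) : Prop :=
  P^T = P /\ forall x : 'cV[R]_n, 0 <= (x^T *m P *m x) 0 0.

(* U and P are not unique in general: U is not determined when S is singular. *)
Definition polar_decomposition (S U P : 'M[R]_n) : Prop :=
  [/\ real_orthogonal U, real_psd P & S = U *m P].

(* The eigenvalues are the entries of the row vector d and the corresponding
   eigenvectors are the columns of V. *)
Definition eigendecomposition (A V : 'M[C]_n) (d : 'rV[C]_n) : Prop :=
  V \is unitarymx /\ A = V *m diag_mx d *m V^t*.

Definition increasing_modulus (d : 'rV[C]_n) : Prop :=
  forall i j : 'I_n, (i <= j)%N -> `|d 0 i| <= `|d 0 j|.

(* Principal argument, in ]-pi, pi]; its value at 0 is a junk value. *)
Definition phase (z : C) : R :=
  let t := acos (complex.Re z / complex.Re `|z|) in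
  if 0 <= complex.Im z then t else - t.

(* A basis that diagonalizes both U and P need not satisfy both orderings: for
   S = diag(2, -1), U = diag(1, -1) has the phases 0, pi in the order opposite
   to that of the eigenvalues 2, 1 of P.  This is why the two orderings are
   predicates of their own and not part of eigendecomposition. *)
Definition increasing_phase (d : 'rV[C]_n) : Prop :=
  forall i j : 'I_n, (i <= j)%N -> phase (d 0 i) <= phase (d 0 j).

(* <u, w> = u^H w, conjugate-linear in the first argument. *)
Definition inner (u w : 'cV[C]_n) : C := (u^t* *m w) 0 0.

Definition fhat (V2 : 'M[C]_n) (f : 'cV[R]_n) (i : 'I_n) : C :=
  inner (col i V2) (map_mx toC f).

Definition pcoef (V1 V2 : 'M[C]_n) (i j : 'I_n) : C :=
  inner (col j V1) (col i V2).

(* The Fourier transform of S depends on S only through the chosen bases. *)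
Definition fourier (V1 V2 : 'M[C]_n) (f : 'cV[R]_n) : 'M[C]_n :=
  \matrix_(i, j) (fhat V2 f i * pcoef V1 V2 i j).

End Definitions.

Lemma phaseP (R : realType) (z : R[i]) : z != 0 ->
  - pi < phase z <= pi
  /\ z = `|z| * Complex (cos (phase z)) (sin (phase z)).
Proof.
case: z => x y z0; rewrite /phase normc_def /=.
set r := Num.sqrt _.
have s0 : 0 < x ^+ 2 + y ^+ 2.
  rewrite lt_neqAle addr_ge0 ?sqr_ge0 // andbT eq_sym.
  rewrite paddr_eq0 ?sqr_ge0 // !sqrf_eq0.
  by apply: contra z0 => /andP[/eqP -> /eqP ->].
have r0 : 0 < r by rewrite sqrtr_gt0.
have r2 : r ^+ 2 = x ^+ 2 + y ^+ 2 by rewrite sqr_sqrtr // ltW.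
have xr : `|x| <= r.
  by rewrite -sqrtr_sqr ler_wsqrtr // lerDl sqr_ge0.
have q1 : -1 <= x / r <= 1.
  by rewrite -ler_norml normrM (gtr0_norm (_ : 0 < r^-1)) ?invr_gt0 //
             ler_pdivrMr // mul1r.
have cosE : cos (acos (x / r)) = x / r by rewrite acosK // in_itv.
have sinE : sin (acos (x / r)) = `|y| / r.
  rewrite sin_acos // -sqrtr_sqr.
  rewrite -{2}(gtr0_norm r0) -(sqrtr_sqr r) -sqrtrV ?sqr_ge0 // -sqrtrM ?sqr_ge0 //.
  by rewrite expr_div_n r2 -{1}(divff (lt0r_neq0 s0)) -mulrBl addrAC subrr add0r.
have rx a : r * (a / r) = a by rewrite mulrC divfK // lt0r_neq0.
split.
  case: ifPn => [_|ylt0].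
    by rewrite acos_lepi // andbT (lt_le_trans _ (acos_ge0 q1)) // oppr_lt0 pi_gt0.
  rewrite ltrN2 acos_ltpi ?(le_trans _ (pi_ge0 _)) ?oppr_le0 ?acos_ge0 //.
  have /andP[h1 ->] := q1; rewrite andbT lt_neqAle h1 andbT.
  apply: contra ylt0 => /eqP h.
  have : x = - r by rewrite -(rx x) -h mulrN1.
  move=> xE; move: r2; rewrite xE sqrrN -[X in X = _]addr0 => /addrI/eqP.
  by rewrite eq_sym sqrf_eq0 => /eqP ->.
apply/eqP; rewrite eq_complex /= !mul0r subr0 addr0.
case: ifPn => [y0|]; rewrite ?cosN ?sinN cosE sinE rx ?mulrN rx eqxx /=.
  by rewrite ger0_norm.
by rewrite -ltNge => y0; rewrite ltr0_norm // opprK.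
Qed.

(* Main.v *)
(** For S = U P normal, S S^T = U P^2 U^T and S^T S = P^2, so U commutes with
    P^2.  In an eigenbasis of P the (i, j) entry of U then vanishes unless
    d_i^2 = d_j^2, that is d_i = d_j because P >= 0; hence U commutes with P
    itself.  The commuting family U, U^H, P is diagonalized by one unitary
    matrix, whose columns can be permuted to meet either ordering convention. *)

Require Import Defs.
From mathcomp Require Import all_boot all_order all_algebra.
From mathcomp Require Import perm sesquilinear spectral.
From mathcomp Require Import complex.
From mathcomp Require Import reals trigo.

Set Implicit Arguments.
Unset Strict Implicit.
Unset Printing Implicit Defensive.

Import Order.TTheory GRing.Theory Num.Theory.
Local Open Scope ring_scope.

(** Sorting the tuple of all indices by the key [f] only permutes it; that permutation later
    reorders the eigenvector columns. *)
Lemma sorting_perm (d : Order.disp_t) (T : orderType d) (n : nat) (f : 'I_n -> T) :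
  exists s : 'S_n, forall i j : 'I_n, (i <= j)%N -> (f (s i) <= f (s j))%O.
Proof.
pose t := sort (relpre f <=%O) (ord_tuple n).
have tot : total (relpre f <=%O) by move=> x y; exact: le_total.
have tr : transitive (relpre f <=%O) by move=> x y z; exact: le_trans.
have /tuple_permP[s ts] : perm_eq t (ord_tuple n) by rewrite perm_sort.
exists s => i j ij.
have st : size t = n by rewrite size_sort size_tuple.
have tE (k : 'I_n) : nth i t k = s k.
  by rewrite ts -[LHS](tnth_nth i [tuple tnth (ord_tuple n) (s x) | x < n] k)
             tnth_mktuple tnth_ord_tuple.
rewrite -!tE.
have srt : sorted (relpre f <=%O) t by exact: sort_sorted.
have refl : reflexive (relpre f <=%O) by move=> x /=.
by apply: (sorted_leq_nth tr refl i srt) => //; rewrite inE st.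
Qed.

Section Adjoint.
Local Open Scope sesquilinear_scope.
Variable C : numClosedFieldType.

Lemma trmxC_mul m n p (A : 'M[C]_(m, n)) (B : 'M[C]_(n, p)) :
  (A *m B)^t* = B^t* *m A^t*.
Proof. by rewrite trmx_mul map_mxM. Qed.

Lemma unitarymxPt n (V : 'M[C]_n) : V \is unitarymx -> V^t* *m V = 1%:M.
Proof. by move=> /unitarymxP /mulmx1C. Qed.

(* Adjoint-closure makes each simultaneously triangularized member both lower
   and upper triangular. *)
Lemma unitary_codiagonalization n (As : seq 'M[C]_n) :
  {in As &, forall A B, comm_mx A B} -> {in As, forall A, A^t* \in As} ->
  exists2 V : 'M[C]_n, V \is unitarymx &
    {in As, forall A, exists d, A = V *m diag_mx d *m V^t*}.
Proof.
move=> Ac Aadj; have [W Wu /allP WA] := cotrigonalization Ac.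
exists (W^t*); first by rewrite trmxC_unitary.
move=> A AAs; pose T := W *m A *m W^t*.
have Ttrig : is_trig_mx T.
  by have := WA _ AAs; rewrite /= /similar_to /= conjymx.
have Tadj : is_trig_mx (T^t*).
  by have := WA _ (Aadj _ AAs); rewrite /= /similar_to /= conjymx // /T !trmxC_mul trmxCK mulmxA.
have /diag_mxP[d dE] : is_diag_mx T.
  apply/is_diag_mxP => i j; rewrite neq_ltn => /orP[ij|ji].
    by move/is_trig_mxP: Ttrig => ->.
  move/is_trig_mxP: Tadj => /(_ j i ji); rewrite !mxE => /eqP.
  by rewrite conjC_eq0 => /eqP.
exists d; rewrite -dE /T trmxCK !mulmxA unitarymxPt // mul1mx.
by rewrite -mulmxA unitarymxPt // mulmx1.
Qed.

Lemma comm_diag_mx_sqr n (d : 'rV[C]_n) (W : 'M[C]_n) :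
  (forall i, 0 <= d 0 i) ->
  comm_mx (diag_mx d *m diag_mx d) W -> comm_mx (diag_mx d) W.
Proof.
move=> d0; rewrite /comm_mx mulmx_diag => dW; apply/matrixP => i j.
move/matrixP: dW => /(_ i j); rewrite !mul_diag_mx !mul_mx_diag !mxE => dW.
have [->|W0] := eqVneq (W i j) 0; first by rewrite mulr0 mul0r.
suff -> : d 0 i = d 0 j by rewrite mulrC.
move: dW; rewrite [RHS]mulrC => /(mulIf W0)/eqP.
by rewrite -!expr2 eqrXn2 // => /eqP.
Qed.

(** The spectral theorem moves the claim to an eigenbasis of [P], where [comm_diag_mx_sqr] applies
    to the conjugate [W] of [U]. *)
Lemma comm_mx_psd_sqr n (P U : 'M[C]_n) : P^t* = P ->
  (forall v : 'rV[C]_n, 0 <= (v *m P *m v^t*) 0 0) ->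
  comm_mx (P *m P) U -> comm_mx P U.
Proof.
move=> Padj Ppos PPU.
have Pn : P \is normalmx by apply/normalmxP; rewrite Padj.
have Vu := spectral_unitarymx P.
move: (orthomx_spectralP Pn); rewrite invmx_unitary //.
set V := spectralmx P in Vu *; set d := spectral_diag P => PE.
have VV := unitarymxP Vu; have VV' := unitarymxPt Vu.
have dE : diag_mx d = V *m P *m V^t*.
  by rewrite PE !mulmxA VV mul1mx -mulmxA VV mulmx1.
have d0 i : 0 <= d 0 i.
  (* Since [P = V^t* *m diag_mx d *m V], each eigenvalue is the value of the quadratic form at a row
     of [V]. *)
  suff -> : d 0 i = (row i V *m P *m (row i V)^t*) 0 0 by exact: Ppos.
  have -> : d 0 i = diag_mx d i i by rewrite mxE eqxx.
  by rewrite dE -row_mul !mxE; apply: eq_bigr => j _; rewrite !mxE.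
pose W := V *m U *m V^t*.
have UE : U = V^t* *m W *m V by rewrite !mulmxA VV' mul1mx -mulmxA VV' mulmx1.
have DW : comm_mx (diag_mx d) W.
  apply: comm_diag_mx_sqr => //; rewrite dE /comm_mx /W.
  have -> : V *m P *m V^t* *m (V *m P *m V^t*) = V *m (P *m P) *m V^t*.
    by rewrite !mulmxA -[V *m P *m V^t* *m V]mulmxA VV' mulmx1.
  rewrite !mulmxA -[_ *m V^t* *m V]mulmxA -[V *m U *m V^t* *m V]mulmxA VV' !mulmx1.
  by have := congr1 (fun X => V *m X *m V^t*) PPU; rewrite !mulmxA.
clearbody W; rewrite /comm_mx UE PE !mulmxA -[_ *m V *m V^t*]mulmxA VV mulmx1.
rewrite -[_ *m V *m V^t*]mulmxA VV mulmx1.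
by rewrite -[_ *m W]mulmxA DW !mulmxA.
Qed.

(** Each entry of [A] is a sum over the eigenpairs, and [s] merely reindexes that sum. *)
Lemma diagonalization_perm n (A V : 'M[C]_n) (d : 'rV[C]_n) (s : 'S_n) :
  A = V *m diag_mx d *m V^t* ->
  A = col_perm s V *m diag_mx (col_perm s d) *m (col_perm s V)^t*.
Proof.
move=> ->; rewrite !mul_mx_diag; apply/matrixP => i k; rewrite !mxE.
by rewrite (reindex_inj (@perm_inj _ s)); apply: eq_bigr => j _; rewrite !mxE.
Qed.

Lemma unitarymx_col_perm n (V : 'M[C]_n) (s : 'S_n) :
  V \is unitarymx -> col_perm s V \is unitarymx.
Proof.
move=> /unitarymxP VV; apply/unitarymxP.
(* Unitarity of [V] is a diagonalization of the identity with all eigenvalues equal to 1. *)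
have := @diagonalization_perm n 1%:M V (const_mx 1) s.
by rewrite col_perm_const diag_const_mx !mulmx1 => <-.
Qed.

End Adjoint.

Section Real.
Local Open Scope sesquilinear_scope.
Variables (R : realType) (n : nat).
Local Notation C := R[i].

Lemma trmxC_toC (m p : nat) (A : 'M[R]_(m, p)) :
  (map_mx toC A)^t* = map_mx toC A^T :> 'M[C]_(p, m).
Proof. by apply/matrixP => i j; rewrite !mxE; exact: conjc_real. Qed.

(* v P v^H = x P x^T + y P y^T when v = x + i y and P is symmetric. *)
Lemma real_psd_toC (P : 'M[R]_n) (v : 'rV[C]_n) : real_psd P ->
  0 <= (v *m map_mx toC P *m v^t*) 0 0.
Proof.
move=> [Psym Ppos].
pose x := map_mx (@complex.Re R) v; pose y := map_mx (@complex.Im R) v.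
have vE : v = map_mx toC x + 'i%C *: map_mx toC y.
  by apply/matrixP => i j; rewrite !mxE -complexE.
have vadj : v^t* = map_mx toC x^T - 'i%C *: map_mx toC y^T.
  apply/matrixP => i j; rewrite !mxE; case: (v j i) => a b.
  by apply/eqP; rewrite eq_complex /= !mul0r mulr0 mul1r !subr0 !add0r !eqxx.
(* A 1 x 1 matrix is its own transpose, so symmetry of [P] makes the two imaginary cross terms
   cancel. *)
have yPx : y *m P *m x^T = x *m P *m y^T.
  have <- : (y *m P *m x^T)^T = x *m P *m y^T by rewrite !trmx_mul trmxK Psym mulmxA.
  by apply/matrixP => i j; rewrite [RHS]mxE !ord1.
have -> : v *m map_mx toC P *m v^t* = map_mx toC (x *m P *m x^T + y *m P *m y^T).
  rewrite vadj vE !mulmxDl !mulmxBr -!scalemxAl -!scalemxAr -!map_mxM yPx map_mxD.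
  by rewrite scalerA -expr2 sqr_i scaleN1r opprK subrKA.
rewrite mxE mxE ler0c addr_ge0 //.
  by have := Ppos x^T; rewrite trmxK.
by have := Ppos y^T; rewrite trmxK.
Qed.

Lemma polar_comm (S U P : 'M[R]_n) :
  real_normal S -> polar_decomposition S U P -> comm_mx (P *m P) U.
Proof.
move=> Sn [UU [PT _] SE]; have UU' := mulmx1C UU.
move: Sn; rewrite /real_normal SE trmx_mul PT !mulmxA.
rewrite -[P *m U^T *m U]mulmxA UU' mulmx1 => UPP.
(* Normality has become [U P^2 U^T = P^2]; multiply on the right by [U]. *)
by rewrite /comm_mx -[in LHS]UPP -mulmxA UU' mulmx1 mulmxA.
Qed.

Lemma polar_codiagonalization (S U P : 'M[R]_n) :
  real_normal S -> polar_decomposition S U P ->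
  exists (V : 'M[C]_n) d1 d2,
    eigendecomposition (map_mx toC U) V d1 /\ eigendecomposition (map_mx toC P) V d2.
Proof.
move=> Sn SUP; have PPU := polar_comm Sn SUP; case: SUP => UU Ppsd _.
set U' := map_mx toC U; set P' := map_mx toC P.
have PT : P'^t* = P' by rewrite trmxC_toC; case: Ppsd => ->.
have UUa : U' *m U'^t* = 1%:M by rewrite trmxC_toC -map_mxM UU map_mx1.
have UaU := mulmx1C UUa.
have PU : comm_mx P' U'.
  apply: comm_mx_psd_sqr => // [v|]; first exact: real_psd_toC.
  by rewrite /comm_mx -!map_mxM PPU.
(* This is the adjoint of [PU], as [P'] is self-adjoint. *)
have UaP : comm_mx (U'^t*) P'.
  by rewrite /comm_mx -[P' in LHS]PT -[P' in RHS]PT -!trmxC_mul PU.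
(* [U'^t*] joins the family to close it under adjoints; it commutes with [U'] because it is its
   inverse. *)
have [||V Vu VD] := @unitary_codiagonalization _ _ [:: U'; U'^t*; P'].
- move=> A B; rewrite !inE => /or3P[]/eqP-> /or3P[]/eqP->;
    by rewrite /comm_mx // ?UUa ?UaU.
- by move=> A; rewrite !inE => /or3P[]/eqP->; rewrite ?trmxCK ?PT eqxx ?orbT.
have [|d1 E1] := VD U'; first by rewrite mem_head.
have [|d2 E2] := VD P'; first by rewrite !inE eqxx !orbT.
by exists V, d1, d2.
Qed.

Lemma eigendecomposition_perm (A V : 'M[C]_n) d (s : 'S_n) :
  eigendecomposition A V d -> eigendecomposition A (col_perm s V) (col_perm s d).
Proof.
by move=> [Vu AE]; split; [exact: unitarymx_col_perm | exact: diagonalization_perm].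
Qed.

(** These coefficients are the entries of the Gram matrix [V^t* *m V], with the two indices
    exchanged. *)
Lemma pcoef_unitary (V : 'M[C]_n) (i j : 'I_n) :
  V \is unitarymx -> pcoef V V i j = if i == j then 1 else 0.
Proof.
move=> /unitarymxPt/matrixP/(_ j i); rewrite /pcoef /inner !mxE eq_sym => VV.
rewrite (eq_bigr (fun k => (V^t*) j k * V k i)) ?VV => [|k _]; last by rewrite !mxE.
by case: eqP.
Qed.

End Real.

Theorem mainTheorem2 (R : realType) (n : nat) (S U P : 'M[R]_n)
    (Snormal : real_normal S) (SUP : polar_decomposition S U P) :
  [/\ exists (V1 V2 : 'M[R[i]]_n) (d1 d2 : 'rV[R[i]]_n),
        [/\ eigendecomposition (map_mx toC U) V1 d1,
            eigendecomposition (map_mx toC P) V2 d2,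
            increasing_modulus d2 & V1 = V2],
      exists (V1 V2 : 'M[R[i]]_n) (d1 d2 : 'rV[R[i]]_n),
        [/\ eigendecomposition (map_mx toC U) V1 d1,
            eigendecomposition (map_mx toC P) V2 d2,
            increasing_phase d1 & V1 = V2]
    & forall (V1 V2 : 'M[R[i]]_n) (d1 d2 : 'rV[R[i]]_n),
        eigendecomposition (map_mx toC U) V1 d1 ->
        eigendecomposition (map_mx toC P) V2 d2 ->
        V1 = V2 ->
        (forall i j : 'I_n, pcoef V1 V2 i j = if i == j then 1 else 0) /\
        (forall (f : 'cV[R]_n) (i j : 'I_n),
            fourier V1 V2 f i j = if i == j then fhat V2 f i else 0)].
Proof.
have [V [d1 [d2 [E1 E2]]]] := polar_codiagonalization Snormal SUP.
split.
(* The order on [R[i]] is partial, so the sorting key is the real part of the modulus; moduli have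
   imaginary part 0, so nothing is lost. *)
- have [s sP] := sorting_perm (fun i => complex.Re `|d2 0 i|).
  exists (col_perm s V), (col_perm s V), (col_perm s d1), (col_perm s d2).
  split; try exact: eigendecomposition_perm; last by [].
  by move=> i j ij; rewrite !mxE lecE sP // andbT !normc_def /= eqxx.
(* The same common basis is now permuted by the phases of [U], in general by another permutation. *)
- have [s sP] := sorting_perm (fun i => phase (d1 0 i)).
  exists (col_perm s V), (col_perm s V), (col_perm s d1), (col_perm s d2).
  split; try exact: eigendecomposition_perm; last by [].
  by move=> i j ij; rewrite !mxE sP.
move=> V1 V2 e1 e2 _ [V2u _] ->.
split=> [i j|f i j]; first exact: pcoef_unitary.
by rewrite mxE pcoef_unitary //; case: eqP => _; rewrite ?mulr1 ?mulr0.
Qed.
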